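(* Let $K$ be a scattered compact Hausdorff space of finite height, let $T:C(K)\to C[0,\omega]$ be a norm-increasing isomorphism, let $t=\|T\|$, and let $\nu_i$ ($i\in[0,\omega]$) and $\nu=\nu_\omega$ be the associated measures on $K$. Suppose that $x\in K^{(1)}$, $C\subseteq K$ is a clopen set containing $x$, and $f\in C(K)$ satisfies (i) $t\ge s=\|Tf\|=\sup_i|\nu_i(f)|>1$; (ii) $f(x)=1=\|f\chi_C\|$. Then $$\text{(a)}\qquad \limsup_{i\to\infty}|\nu_i|(C)\ \ge\ 2\,\frac{s-|\nu(f)|}{s-1}-|\nu(f\chi_C)|;$$ $$\text{(b)}\qquad t\ \ge\ 2\,\frac{s-|\nu(f)|}{s-1}-|\nu(f\chi_C)|+|\nu|(K\setminus C).$$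
   Context: $C(K)$ is the Banach space of real-valued continuous functions on $K$ with the supremum norm; its dual is identified with $M(K)$, the regular signed Borel measures on $K$ of finite variation, and $\mu(g)=\int_K g\,d\mu$; $|\mu|$ is the variation of $\mu$. $[0,\omega]$ is the ordinal interval $\omega+1$ with the order topology (a convergent sequence with its limit). An isomorphism is a bounded linear bijection with bounded inverse; it is norm-increasing if $\|Tg\|\ge\|g\|$ for all $g\in C(K)$. The associated measures are $\nu_i=T^*\delta_i\in M(K)$ for $i\in[0,\omega]$, i.e. $\nu_i(g)=Tg(i)$ for $g\in C(K)$, and $\nu=\nu_\omega$. $K^{(1)}$ is the set of non-isolated points of $K$; $K$ is scattered of finite height if $K^{(n)}=\emptyset$ for some natural $n$, where $K^{(0)}=K$ and $K^{(n+1)}$ is the set of non-isolated points of $K^{(n)}$. $\chi_C$ is the characteristic function of $C$. *)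

(* Defs.v *)
From HB Require Import structures.
From mathcomp Require Import all_boot all_order all_algebra.
From mathcomp Require Import all_classical all_reals all_analysis.
Set Implicit Arguments.
Unset Strict Implicit.
Unset Printing Implicit Defensive.
Import Order.TTheory GRing.Theory Num.Theory.
Import numFieldNormedType.Exports.
Local Open Scope classical_set_scope.
Local Open Scope ring_scope.

(* The ordinal interval [0, omega]: [Some n] is the ordinal n and [None] is
   omega. The [Order_isNbhs] instance proves that the topology is the order
   topology. *)
Definition omega_itv : Type := one_point_compactification nat.

HB.instance Definition _ := PointedTopological.on omega_itv.

Definition omega_le (a b : omega_itv) : bool :=
  match a, b with
  | _, None => true
  | None, Some _ => false
  | Some m, Some n => (m <= n)%N
  end.

Fact omega_itv_display : Order.disp_t. Proof. exact: Order.Disp tt tt. Qed.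

Lemma omega_le_refl : reflexive omega_le.
Proof. by case=> //= n; exact: leqnn. Qed.

Lemma omega_le_anti : antisymmetric omega_le.
Proof. by move=> [m|] [n|] //=; rewrite -eqn_leq => /eqP ->. Qed.

Lemma omega_le_trans : transitive omega_le.
Proof. by move=> [n|] [m|] [p|] //=; exact: leq_trans. Qed.

HB.instance Definition _ := Order.Le_isPOrder.Build omega_itv_display omega_itv
  omega_le_refl omega_le_anti omega_le_trans.

Lemma omega_le_total : total (<=%O : rel omega_itv).
Proof. by move=> [m|] [n|] //; exact: leq_total. Qed.

HB.instance Definition _ :=
  Order.POrder_isTotal.Build omega_itv_display omega_itv omega_le_total.

Lemma omega_ltE (m n : nat) :
  ((Some m : omega_itv) < (Some n : omega_itv))%O = (m < n)%N.
Proof. by rewrite ltNge [in RHS]ltnNge. Qed.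

Lemma compact_nat_bounded (C : set nat) : compact C ->
  exists N, C `<=` [set k | (k <= N)%N].
Proof.
rewrite compact_cover => cC.
have [n _|n _|D _ CD] := cC nat setT (fun n => [set n]).
- exact: discrete_open.
- by exists n.
exists (\max_(i <- finmap.enum_fset D) i)%N => n /CD[i iD] /= ->.
exact: (leq_bigmax_seq (F := id)).
Qed.

Lemma omega_itv_nbhsE (x : omega_itv) : nbhs x = filter_from
    (fun i => itv_open_ends i /\ x \in i)
    (fun i : interval omega_itv => [set` i]).
Proof.
rewrite eqEsubset; split=> U.
- case: x => [[|n]|] /=.
  + move=> /nbhs_singleton /= U0.
    exists `]-oo, (Some 1%N : omega_itv)[; first by split => //; rewrite in_itv.
    by move=> [[|m]|] //=; rewrite in_itv /= ?omega_ltE.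
  + move=> /nbhs_singleton /= Un.
    exists `](Some n : omega_itv), (Some n.+2 : omega_itv)[.
      by split => //; rewrite in_itv /= !omega_ltE !leqnn.
    move=> [m|] /=; rewrite in_itv /= ?omega_ltE ?andbF//.
    by rewrite ltnS -eqn_leq => /eqP <-.
  + move=> [C [/compact_nat_bounded[N CN] _] CU].
    exists `](Some N : omega_itv), +oo[; first by split => //; rewrite in_itv.
    move=> [m|] /=; rewrite in_itv /= ?andbT ?omega_ltE => Nm; apply: CU.
      by left; exists m => // /CN /=; rewrite leqNgt Nm.
    by right.
- move=> [i [oi xi] iU]; case: x xi => [n|] xi.
    by apply: (@filterS _ (nbhs n) _ [set n]) => [m ->|];
      [exact: iU | exact: discrete_set1].
  case: i oi xi iU => [[[] [m|]|[]] [[] [p|]|[]]] //= _.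
  all: rewrite ?in_itv //= => _ iU.
  + exists `I_m.+1.
      by split; [exact/finite_compact/finite_II | exact: discrete_closed].
    move=> _ [[k /= /negP km <-]|->]; apply: iU => /=; rewrite in_itv//=.
    by rewrite andbT omega_ltE ltnNge.
  + exists set0; first by split; [exact: compact0 | exact: closed0].
    by move=> y _; apply: iU; rewrite /= in_itv.
Qed.

HB.instance Definition _ :=
  Order_isNbhs.Build omega_itv_display omega_itv omega_itv_nbhsE.

(* C(K), with the pointwise vector space structure. *)
Section cont_fun.
Context (K : topologicalType) (R : realType).

Definition cont_fun : Type := continuousType K R.

HB.instance Definition _ := Choice.on cont_fun.

Implicit Types f g h : cont_fun.

Lemma cont_zero_subproof : continuous (fun _ : K => 0 : R).
Proof. by move=> x; exact: cvg_cst. Qed.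

Lemma cont_opp_subproof f : continuous (fun x => - f x).
Proof. by move=> x; apply: continuousN; exact: cts_fun. Qed.

Lemma cont_add_subproof f g : continuous (fun x => f x + g x).
Proof. by move=> x; apply: continuousD; exact: cts_fun. Qed.

Lemma cont_scale_subproof (a : R) f : continuous (fun x => a * f x).
Proof. by move=> x; apply: continuousM; [exact: cvg_cst | exact: cts_fun]. Qed.

Definition cont_zero : cont_fun := mkcts cont_zero_subproof.
Definition cont_opp f : cont_fun := mkcts (@cont_opp_subproof f).
Definition cont_add f g : cont_fun := mkcts (@cont_add_subproof f g).
Definition cont_scale (a : R) f : cont_fun := mkcts (@cont_scale_subproof a f).

Lemma cont_addA : associative cont_add.
Proof. by move=> f g h; apply/continuousEP => x; exact: addrA. Qed.

Lemma cont_addC : commutative cont_add.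
Proof. by move=> f g; apply/continuousEP => x; exact: addrC. Qed.

Lemma cont_add0 : left_id cont_zero cont_add.
Proof. by move=> f; apply/continuousEP => x; exact: add0r. Qed.

Lemma cont_addN : left_inverse cont_zero cont_opp cont_add.
Proof. by move=> f; apply/continuousEP => x; exact: addNr. Qed.

HB.instance Definition _ :=
  GRing.isZmodule.Build cont_fun cont_addA cont_addC cont_add0 cont_addN.

Lemma cont_scaleA a b f : cont_scale a (cont_scale b f) = cont_scale (a * b) f.
Proof. by apply/continuousEP => x; exact: mulrA. Qed.

Lemma cont_scale1 : left_id 1 cont_scale.
Proof. by move=> f; apply/continuousEP => x; exact: mul1r. Qed.

Lemma cont_scaleDr : right_distributive cont_scale +%R.
Proof. by move=> a f g; apply/continuousEP => x; exact: mulrDr. Qed.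

Lemma cont_scaleDl f : {morph cont_scale^~ f : a b / a + b}.
Proof. by move=> a b; apply/continuousEP => x; exact: mulrDl. Qed.

HB.instance Definition _ := GRing.Zmodule_isLmodule.Build R cont_fun
  cont_scaleA cont_scale1 cont_scaleDr cont_scaleDl.

End cont_fun.

(* On compact spaces the suprema below are suprema of bounded sets; on a
   bounded operator so is the one in [op_norm]. *)
Definition sup_norm (X : Type) (R : realType) (f : X -> R) : R :=
  sup [set `|f x| | x in setT].

Section operators.
Context (R : realType) (K L : topologicalType).

Definition bounded_op (T : cont_fun K R -> cont_fun L R) : Prop :=
  exists M : R, forall g : cont_fun K R, sup_norm (T g) <= M * sup_norm g.

Definition op_norm (T : cont_fun K R -> cont_fun L R) : R :=
  sup [set sup_norm (T g) | g in [set g : cont_fun K R | sup_norm g <= 1]].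

Definition norm_increasing (T : cont_fun K R -> cont_fun L R) : Prop :=
  forall g : cont_fun K R, sup_norm g <= sup_norm (T g).

End operators.

Definition isomorphism (R : realType) (K L : topologicalType)
    (T : {linear cont_fun K R -> cont_fun L R}) : Prop :=
  bounded_op T /\
  exists S : cont_fun L R -> cont_fun K R,
    [/\ cancel T S, cancel S T & bounded_op S].

(* [cb_derivative K n] is the n-th derived set of K; [isolated A] is the set of
   isolated points of A in the subspace topology. *)
Definition cb_derivative (K : topologicalType) (n : nat) : set K :=
  iter n (fun A => A `\` isolated A) setT.
Arguments cb_derivative : clear implicits.

Definition finite_height (K : topologicalType) : Prop :=
  exists n, cb_derivative K n = set0.

Notation borel K := (g_sigma_algebraType (@open K)).

Section signed_measures.
Context d (X : measurableType d) (R : realType).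
Variable mu : {charge set X -> \bar R}.

(* A Hahn decomposition of X for mu; the Jordan parts of mu do not depend on
   its choice. *)
Definition hahn_pos : set X := projT1 (cid (Hahn_decomposition mu)).
Definition hahn_neg : set X :=
  projT1 (cid (projT2 (cid (Hahn_decomposition mu)))).
Definition hahnP : hahn_decomposition mu hahn_pos hahn_neg :=
  projT2 (cid (projT2 (cid (Hahn_decomposition mu)))).

Definition abs_charge : {measure set X -> \bar R} := charge_variation hahnP.

Definition charge_int (g : X -> R) : R :=
  \int[jordan_pos hahnP]_x g x - \int[jordan_neg hahnP]_x g x.

End signed_measures.

(* Charges are finite by definition, so that M(K) consists of the regular
   charges on [borel K]. *)
Definition regular_charge (R : realType) (K : ptopologicalType)
    (mu : {charge set (borel K) -> \bar R}) : Prop :=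
  forall (A : set (borel K)) (e : R), measurable A -> 0 < e ->
  exists F U : set K,
    [/\ compact F, open U, F `<=` A, A `<=` U &
       (abs_charge mu (U `\` F) < e%:E)%E].

(* The identification of the dual of C(K) with M(K): [nu i] represents the
   evaluation of T at i. *)
Definition associated_measures (R : realType) (K : ptopologicalType)
    (L : topologicalType) (T : cont_fun K R -> cont_fun L R)
    (nu : L -> {charge set (borel K) -> \bar R}) : Prop :=
  forall i, regular_charge (nu i) /\
    forall g : cont_fun K R, charge_int (nu i) g = T g i.

(* Main.v *)
Require Import Defs.
From mathcomp Require Import all_boot all_order all_algebra.
From mathcomp Require Import ring lra.
From mathcomp Require Import all_classical all_reals all_analysis.
Set Implicit Arguments.
Unset Strict Implicit.
Unset Printing Implicit Defensive.
Import Order.TTheory GRing.Theory Num.Theory.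
Import numFieldNormedType.Exports.
Local Open Scope classical_set_scope.
Local Open Scope ring_scope.

(** Write [q] for [`|T f None|], [p] for [`|T (f \1_C) None|] and [L] for
[(s - q) / (s - 1)].

Isolated points of [K] accumulate at [x], because a space of finite height has
dense isolated points.  For a fixed [i], only finitely many isolated points
[y] have [`|T \1_y i|] above a given threshold, since a signed sum of [m] such
indicators has norm at most 1 and is sent to a number growing with [m]
([finite_large_atoms]).  So [y] can be taken isolated, as close to [x] as
desired, and almost invisible to [T] at [omega] and at any prescribed finite
set of indices.

For such a [y] and [r] slightly above [s - 1], the function [f + r \1_y] has
norm at least about [1 + r > s], and [T] does not decrease it.  The norm of its image
must then be attained at an index [n] where [T \1_y] is not small, hence at a
large [n], where [T f n] is close to [T f omega].  There
[q + r `|T \1_y n|] is almost at least [1 + r], that is, [`|T \1_y n|] is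
almost at least [L]: the measure [nu n] has an atom at [y] of mass at least
[L] up to an error ([exists_large_atom]).  As [T (f \1_C) n] is close to
[T (f \1_C) omega], of modulus [p], this atom must be compensated
by a mass of about [L - p] on the rest of [C].  Choosing signs gives a test
function [h] in the unit ball, supported in [C], with [T h n] almost at least
[2 * L - p] ([exists_large_test]).  Since [`|nu n| C >= T h n], this is (a).

For (b), regularity of [nu omega] and Urysohn's lemma give [g] in the unit
ball, supported off [C], whose integral against [nu omega] is almost
[`|nu omega| (~` C)] ([variation_approx]).  Then [h + g] is again in the unit
ball, so [t >= T h n + T g n], and [T g n] is close to [T g omega]. *)

(** * Indicators and suprema in spaces of continuous functions *)

Lemma continuous_indic (K : topologicalType) (R : realType) (A : set K) :
  clopen A -> continuous (\1_A : K -> R).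
Proof.
move=> [oA cA] y; have [Ay|nAy] := pselect (A y).
- apply: cvg_near_cst; near=> z.
  rewrite !indicE !mem_set //; near: z; exact: open_nbhs_nbhs.
- apply: cvg_near_cst; near=> z.
  rewrite !indicE !memNset //; near: z.
  by apply: open_nbhs_nbhs; split=> //; exact: closed_openC.
Unshelve. all: by end_near. Qed.

Definition cont_mul (K : topologicalType) (R : realType) (f g : cont_fun K R) :
    cont_fun K R :=
  mkcts (fun y => continuousM (cts_fun (s:=f) y) (cts_fun (s:=g) y)).

(** The zero function stands in for the indicator of a set that is not clopen;
this keeps sums over families of sets free of clopenness proofs. *)
Definition cont_indic (K : topologicalType) (R : realType) (A : set K) :
    cont_fun K R :=
  if pselect (clopen A) is left cA
  then mkcts (@continuous_indic K R A cA) else 0.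

Lemma cont_indicE (K : topologicalType) (R : realType) (A : set K) (y : K) :
  clopen A -> cont_indic R A y = \1_A y.
Proof. by rewrite /cont_indic; case: pselect. Qed.

Lemma ler_sup_norm (X : topologicalType) (R : realType) (g : cont_fun X R) y :
  compact [set: X] -> `|g y| <= sup_norm g.
Proof.
move=> cX; apply: ub_le_sup; last by exists y.
have cg : compact (g @` setT).
  apply: continuous_compact cX; apply: continuous_subspaceT; exact: cts_fun.
have [M [_ /(_ (M + 1))]] := compact_bounded cg.
rewrite ltrDl ltr01 => /(_ isT) gM; exists (M + 1) => _ [z _ <-].
by apply: gM; exists z.
Qed.

Lemma sup_norm_ler (X : pointedType) (R : realType) (g : X -> R) (M : R) :
  (forall y, `|g y| <= M) -> sup_norm g <= M.
Proof.
move=> gM; apply: ge_sup; first by exists `|g point|; exists point.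
by move=> _ [y _ <-].
Qed.

Lemma ler_op_norm (K : ptopologicalType) (L : ptopologicalType) (R : realType)
    (T : cont_fun K R -> cont_fun L R) (g : cont_fun K R) (i : L) :
    compact [set: K] -> compact [set: L] -> bounded_op T ->
  (forall y, `|g y| <= 1) -> `|T g i| <= op_norm T.
Proof.
move=> cK cL [M TM] g1; apply: (le_trans (ler_sup_norm (T g) i cL)).
apply: ub_le_sup; last by exists g => //; exact: (@sup_norm_ler K).
exists `|M| => _ [h h1 <-]; apply: (le_trans (TM h)).
apply: (@le_trans _ _ (`|M| * `|sup_norm h|)).
  by rewrite -normrM ler_norm.
have h0 : 0 <= sup_norm h.
  exact: le_trans (normr_ge0 (h point)) (ler_sup_norm h point cK).
by rewrite (ger0_norm h0) ler_piMr.
Qed.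

Lemma omega_cvg (R : realType) (g : cont_fun omega_itv R) (e : R) : 0 < e ->
  exists N : nat, forall n, (N <= n)%N -> `|g None - g (Some n)| < e.
Proof.
move=> e0.
have gc : g @ (None : omega_itv) --> g None by apply: cts_fun.
have := @cvgr_dist_lt _ _ _ _ _ _ _ gc _ e0.
case=> C [/compact_nat_bounded[N CN] _] CU; exists N.+1 => n Nn.
by apply: CU; left; exists n => // /CN /=; rewrite leqNgt Nn.
Qed.

(** * Isolated points of a space of finite height *)

(** If [U] had no isolated point of [K], then, [U] being open, no step of the
derivation could remove a point of [U], and no derived set would be empty. *)
Lemma exists_isolated (K : topologicalType) (U : set K) :
  finite_height K -> open U -> U !=set0 -> exists2 y, U y & isolated setT y.
Proof.
move=> [n Kn0] oU [u Uu]; apply: contrapT => noiso.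
suff UK m : U `<=` cb_derivative K m by have := UK n u Uu; rewrite Kn0.
elim: m => [//|m IH] y Uy; split; first exact: IH.
move=> [_ [V nV Vm]]; apply: noiso; exists y => //; split; first exact: in_setT.
exists (V `&` U); first by apply: filterI => //; exact: open_nbhs_nbhs.
rewrite setIT -Vm; apply/seteqP; split=> z [Vz]; first by split=> //; exact: IH.
move=> zm; have : (V `&` cb_derivative K m) z by [].
by rewrite Vm => ->; split=> //; exact: nbhs_singleton.
Qed.

Lemma isolated_clopen (K : topologicalType) (y : K) :
  accessible_space K -> isolated setT y -> clopen [set y].
Proof.
move=> aK [_ [V nV]]; rewrite setIT => Vy; split.
  by rewrite openE => z /= ->; rewrite -Vy.
exact: accessible_closed_set1.
Qed.

(** * Images of the indicators of isolated points *)

Lemma cont_sumE (K : topologicalType) (R : realType) (I : Type) (r : seq I)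
    (F : I -> cont_fun K R) (z : K) :
  (\sum_(i <- r) F i) z = \sum_(i <- r) F i z.
Proof. by elim/big_rec2: _ => [//|i u v _ <-]. Qed.

Lemma sgr_le1 (R : realType) (a : R) : `|Num.sg a| <= 1.
Proof. by rewrite normr_sg; case: (_ != _). Qed.

(** If infinitely many [y] were large at [i], the sum of [m] of their
indicators, each with the sign of its image at [i], would lie in the unit ball
and have image at least [m * d] at [i], for every [m]. *)
Lemma finite_large_atoms (K L : ptopologicalType) (R : realType)
    (T : {linear cont_fun K R -> cont_fun L R}) (i : L) (d : R) :
  compact [set: K] -> compact [set: L] -> hausdorff_space K ->
  bounded_op T -> 0 < d ->
  finite_set [set y | isolated setT y /\ d <= `|T (cont_indic R [set y]) i| ].
Proof.
move=> cK cL hK bT d0; apply: contrapT => infA.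
have [m mT] : exists m : nat, op_norm T < m%:R * d.
  exists (Num.truncn (op_norm T / d)).+1.
  by rewrite -ltr_pdivrMr// truncnS_gt.
have [B BA mB] := infinite_set_fset m infA.
pose c y := Num.sg (T (cont_indic R [set y]) i).
pose g : cont_fun K R := \sum_(y <- finmap.enum_fset B) c y *: cont_indic R [set y].
have clB y : y \in finmap.enum_fset B -> clopen [set y].
  move=> yB; apply: isolated_clopen; first exact: hausdorff_accessible.
  by case: (BA y yB).
have gE z : g z = \sum_(y <- finmap.enum_fset B) c y * \1_[set y] z.
  rewrite cont_sumE; apply: eq_big_seq => y yB.
  by rewrite -(@cont_indicE K R [set y] z)//; exact: clB.
have g1 z : `|g z| <= 1.
  rewrite gE; have [zB|zB] := boolP (z \in finmap.enum_fset B).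
    rewrite (bigD1_seq z) ?finmap.fset_uniq//= big1 ?addr0.
      by rewrite indicE mem_set//= mulr1 sgr_le1.
    move=> y yz; rewrite indicE memNset ?mulr0//= => zy.
    by rewrite zy eqxx in yz.
  rewrite big_seq big1 ?normr0// => y yB.
  by rewrite indicE memNset ?mulr0//= => zy; rewrite zy yB in zB.
have := ler_op_norm i cK cL bT g1; apply/negP; rewrite -ltNge.
apply: (lt_le_trans mT).
have -> : T g i = \sum_(y <- finmap.enum_fset B) `|T (cont_indic R [set y]) i|.
  rewrite linear_sum cont_sumE; apply: eq_bigr => y _.
  by rewrite linearZ normrEsg.
apply: (le_trans _ (ler_norm _)).
apply: (@le_trans _ _ (\sum_(y <- finmap.enum_fset B) d)).
  rewrite big_const_seq count_predT iter_addr addr0 -[leRHS]mulr_natl ler_pM2r//.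
  by rewrite ler_nat.
by rewrite big_seq [leRHS]big_seq; apply: ler_sum => y /BA[].
Qed.

Lemma exists_small_atom (K : ptopologicalType) (R : realType)
    (T : {linear cont_fun K R -> cont_fun omega_itv R}) (x : K) (U : set K)
    (d : R) (N : nat) :
  compact [set: K] -> hausdorff_space K -> finite_height K -> bounded_op T ->
  cb_derivative K 1 x -> open U -> U x -> 0 < d ->
  exists y, [/\ isolated setT y, U y, `|T (cont_indic R [set y]) None| < d &
    forall n, (n < N)%N -> `|T (cont_indic R [set y]) (Some n)| < d].
Proof.
move=> cK hK fK bT [_ nx] oU Ux d0.
have fin i := finite_large_atoms i cK one_point_compactification_compact hK bT d0.
pose bad i := [set y | isolated setT y /\ d <= `|T (cont_indic R [set y]) i|].
pose A := bad None `|` \bigcup_(n < N) bad (Some n).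
have finA : finite_set A.
  rewrite finite_setU; split; first exact: (fin None).
  by apply: bigcup_finite => [|n _]; [exact: finite_II|exact: (fin (Some n))].
have clA : closed A.
  have /accessible_finite_set_closed := hausdorff_accessible hK.
  exact.
have [y [Uy nAy] yi] : exists2 y, (U `\` A) y & isolated setT y.
  apply: exists_isolated => //; first by rewrite setDE; apply: openI => //; exact: closed_openC.
  by exists x; split=> // -[[/nx]//|[n _ [/nx]]].
exists y; split => //.
  by rewrite ltNge; apply/negP => yd; apply: nAy; left.
by move=> n nN; rewrite ltNge; apply/negP => yd; apply: nAy; right; exists n.
Qed.

Lemma sup_norm_adherent (X : pointedType) (R : realType) (g : X -> R) (e : R) :
  0 < e -> exists y, sup_norm g - e < `|g y|.
Proof.
move=> e0; apply: contrapT => H.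
have : sup_norm g <= sup_norm g - e.
  apply: (@sup_norm_ler X) => y; rewrite leNgt; apply/negP => ?; apply: H; by exists y.
by rewrite lerBrDr -lerBrDl subrr leNgt e0.
Qed.

Lemma exists_small (R : realType) (a b e : R) : 0 <= a -> 0 < b -> 0 < e ->
  exists d : R, [/\ 0 < d, d <= b & d * a <= e].
Proof.
move=> a0 b0 e0; have a1 : 0 < a + 1 by rewrite ltr_wpDl.
exists (Num.min b (e / (a + 1))); split.
- by rewrite lt_min b0 divr_gt0.
- by rewrite ge_min lexx.
- apply: (@le_trans _ _ (e / (a + 1) * (a + 1))); last by rewrite divfK// gt_eqF.
  apply: ler_pM; rewrite ?le_min ?ge_min ?lexx ?orbT//; last by rewrite lerDl.
  by rewrite ltW//= ltW// divr_gt0.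
Qed.

(** Take [y] almost invisible to [T] at [omega] and below a large index.  The
norm of the image of [f + r \1_y] exceeds [s + r e], so it is attained at an
index beyond that one, where [`|T f n|] is at most [`|T f None| + e].  Here
[r] has to be above [s - 1] for the excess over [s] to exist, and the bound
[(1 + r - `|T f None|) / r] obtained for [`|T \1_y n|] tends to the stated one as
[r] tends to [s - 1]. *)
Lemma exists_large_atom (K : ptopologicalType) (R : realType)
    (T : {linear cont_fun K R -> cont_fun omega_itv R}) (x : K) (U : set K)
    (f : cont_fun K R) (s d : R) (N : nat) :
  compact [set: K] -> hausdorff_space K -> finite_height K -> bounded_op T ->
  norm_increasing T -> cb_derivative K 1 x -> open U -> U x ->
  f x = 1 -> 1 < s -> (forall i, `|T f i| <= s) -> 0 < d ->
  exists y n, [/\ (N <= n)%N, isolated setT y, U y, `|f y - 1| < d &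
    (s - `|T f None|) / (s - 1) - d <= `|T (cont_indic R [set y]) (Some n)|].
Proof.
move=> cK hK fK bT iT x1 oU Ux fx s1 Tfs d0.
set q := `|T f None|; have qs : q <= s := Tfs None.
set L := (s - q) / (s - 1).
have sL : (s - 1) * L = s - q.
  by rewrite mulrC divfK// gt_eqF// subr_gt0.
have L0 : 0 <= L by rewrite divr_ge0// subr_ge0// ltW.
have [e [e0 eb eL]] : exists e : R, [/\ 0 < e, e <= Num.min (1/2) d &
    e * (2 * L * (s + 2) + 3) <= d * (s - 1)].
  apply: exists_small; last by rewrite mulr_gt0// subr_gt0.
    have s2 : 0 <= s + 2 by lra.
    by have := mulr_ge0 L0 s2; lra.
  by rewrite lt_min d0 andbT.
move: eb; rewrite le_min => /andP[e2 ed].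
(* With this excess over [s - 1], [1 + r - 2 * e] is at least [s + r * e]. *)
pose r := s - 1 + 2 * (s + 2) * e.
have se0 : 0 < (s + 2) * e by rewrite mulr_gt0//; lra.
have rE : r = s - 1 + 2 * (s + 2) * e by [].
have rs : s - 1 < r by rewrite rE; lra.
have r0 : 0 < r by lra.
have [N1 N1f] := omega_cvg (T f) e0.
have nbx : nbhs x [set y | `|f y - 1| < e].
  have fc : f @ x --> f x by exact: cts_fun.
  have := @cvgr_distC_lt _ _ _ _ _ _ _ fc _ e0.
  by rewrite fx; apply.
pose W := [set y | `|f y - 1| < e]° `&` U.
have [y [yi [/interior_subset /= fy Uy] yN yn]] :
  exists y, [/\ isolated setT y, W y, `|T (cont_indic R [set y]) None| < e &
    forall n, (n < maxn N N1)%N -> `|T (cont_indic R [set y]) (Some n)| < e].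
  apply: (exists_small_atom _ _ _ _ _ x1) => //.
  by apply: openI => //; exact: open_interior.
pose chi := cont_indic R [set y].
have chiy : chi y = 1.
  rewrite cont_indicE ?indicE ?mem_set//.
  by apply: isolated_clopen => //; exact: hausdorff_accessible.
pose h : cont_fun K R := f + r *: chi.
have hy : 1 + r - e <= sup_norm h.
  apply: le_trans (ler_sup_norm h y cK); apply: le_trans (ler_norm _).
  have -> : h y = f y + r * chi y by [].
  by rewrite chiy; move: fy; rewrite ltr_norml => /andP[]; lra.
have [i iT1] := sup_norm_adherent (T h) e0.
have Thi : `|T h i| <= `|T f i| + r * `|T chi i|.
  rewrite linearD linearZ.
  have -> : (T f + r *: T chi) i = T f i + r * T chi i by [].
  by rewrite (le_trans (ler_normD _ _))// normrM (gtr0_norm r0).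
(* [i] nearly realizes the norm of [T h]; at [omega] and at small indices the
   image of [chi] is below [e], too little for that. *)
have big : 1 + r - 2 * e < `|T f i| + r * `|T chi i|.
  by have := iT h; lra.
have small : `|T chi i| < e -> False.
  move=> ce; have rc : r * `|T chi i| <= r * e by rewrite ler_wpM2l ?ltW.
  have re : r * e <= 2 * (s + 2) * e - 2 * e.
    by have := ler_wpM2l (ltW se0) e2; rewrite rE; lra.
  by have := Tfs i; move: rE; lra.
case: i iT1 Thi big small => [n|] iT1 Thi big small; last by case: (small yN).
have [nN|nN] := leqP (maxn N N1) n; last by case: (small (yn _ nN)).
exists y, n; split => //; first by apply: leq_trans nN; exact: leq_maxl.
  exact: lt_le_trans fy ed.
have fq : `|T f (Some n)| <= q + e.
  have nN1 : (N1 <= n)%N by apply: leq_trans nN; exact: leq_maxr.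
  have := ltW (N1f _ nN1); rewrite distrC => Hq.
  have := lerB_dist (T f (Some n)) (T f None); rewrite -/q; lra.
rewrite -(ler_pM2l r0).
apply: (@le_trans _ _ (1 + r - 3 * e - q)); last by rewrite -/chi; lra.
have dr : d * (s - 1) <= d * r by rewrite ler_wpM2l// ltW.
have -> : r * (L - d) = (s - 1) * L + 2 * (s + 2) * e * L - d * r.
  by rewrite /r; ring.
rewrite sL; move: eL.
have -> : e * (2 * L * (s + 2) + 3) = 2 * (s + 2) * e * L + 3 * e by ring.
by move: rE; lra.
Qed.

(** The atom at [y] and the function [f \1_C - f y \1_y], which lives on the rest
of [C], are combined with the signs of their images at [n]. The image of the second has
modulus at least [`|f y| `|T \1_y n| - `|T (f \1_C) n|], hence the factor 2. *)
Lemma exists_large_test (K : ptopologicalType) (R : realType)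
    (T : {linear cont_fun K R -> cont_fun omega_itv R}) (x : K) (C : set K)
    (f : cont_fun K R) (s e : R) (N : nat) :
  compact [set: K] -> hausdorff_space K -> finite_height K -> bounded_op T ->
  norm_increasing T -> cb_derivative K 1 x -> clopen C -> C x ->
  f x = 1 -> (forall y, C y -> `|f y| <= 1) ->
  1 < s -> (forall i, `|T f i| <= s) -> 0 < e ->
  exists n (h : cont_fun K R), [/\ (N <= n)%N, forall y, `|h y| <= 1,
    forall y, ~ C y -> h y = 0 &
    2 * ((s - `|T f None|) / (s - 1)) -
      `|T (cont_mul f (cont_indic R C)) None| - e <= T h (Some n)].
Proof.
move=> cK hK fK bT iT x1 clC Cx fx fC s1 Tfs e0.
set fc := cont_mul f (cont_indic R C); set p := `|T fc None|.
set L := (s - _) / (s - 1).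
have L0 : 0 <= L by rewrite divr_ge0// subr_ge0// ltW.
have [d [d0 d1 dL]] : exists d : R, [/\ 0 < d, d <= 1 & d * (3 + L) <= e].
  by apply: exists_small => //; lra.
have [N1 N1f] := omega_cvg (T fc) d0.
have [y [n [nN yi Cy fy La]]] : exists y n, [/\ (maxn N N1 <= n)%N,
    isolated setT y, C y, `|f y - 1| < d &
    L - d <= `|T (cont_indic R [set y]) (Some n)|].
  by apply: exists_large_atom fx s1 Tfs d0 => //; case: clC.
set chi := cont_indic R [set y] in La *.
have chiE z : chi z = \1_[set y] z.
  rewrite cont_indicE//.
  by apply: isolated_clopen => //; exact: hausdorff_accessible.
have fcE z : fc z = f z * \1_C z by rewrite -(cont_indicE R z clC).
pose g : cont_fun K R := fc - f y *: chi.
have gE z : g z = f z * \1_C z - f y * \1_[set y] z by rewrite -fcE -chiE.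
pose a := T chi (Some n); pose b := T g (Some n).
pose h : cont_fun K R := Num.sg a *: chi + Num.sg b *: g.
have hE z : h z = Num.sg a * \1_[set y] z + Num.sg b * (f z * \1_C z - f y * \1_[set y] z).
  by rewrite -gE -chiE.
exists n, h; split.
- by apply: leq_trans nN; exact: leq_maxl.
- move=> z; rewrite hE; have [->|zy] := pselect (z = y).
    by rewrite !indicE !mem_set//= !mulr1 subrr mulr0 addr0 sgr_le1.
  rewrite (indicE _ [set y]) memNset//= !mulr0 subr0 add0r.
  have [Cz|nCz] := pselect (C z).
    by rewrite indicE mem_set//= mulr1 normrM mulr_ile1// ?sgr_le1// fC.
  by rewrite indicE memNset//= !mulr0 normr0.
- move=> z nCz; rewrite hE !indicE !memNset//= ?mulr0 ?subr0 ?mulr0 ?addr0//.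
  by move=> zy; apply: nCz; rewrite zy.
have -> : T h (Some n) = `|a| + `|b|.
  rewrite linearD !linearZ.
  have -> : (Num.sg a *: T chi + Num.sg b *: T g) (Some n) =
    Num.sg a * a + Num.sg b * b by [].
  by rewrite -!normrEsg.
have bE : b = T fc (Some n) - f y * a by rewrite /b linearB linearZ.
have Tfc : `|T fc (Some n)| <= p + d.
  have nN1 : (N1 <= n)%N by apply: leq_trans nN; exact: leq_maxr.
  have := ltW (N1f _ nN1); rewrite distrC => Hq.
  have := lerB_dist (T fc (Some n)) (T fc None); rewrite -/p; lra.
have fya : (1 - d) * `|a| <= `|f y * a|.
  rewrite normrM ler_wpM2r//; apply: le_trans (ler_norm _).
  by move: fy; rewrite ltr_norml => /andP[]; lra.
have bge : `|f y * a| - `|T fc (Some n)| <= `|b|.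
  by rewrite bE distrC; exact: lerB_dist.
have : (2 - d) * (L - d) <= (2 - d) * `|a| by rewrite ler_wpM2l//; lra.
have := mulr_ge0 (ltW d0) (ltW d0).
lra.
Qed.

(** * Integration of continuous functions against Borel charges *)

Lemma open_measurable_borel (K : ptopologicalType) (A : set K) :
  open A -> measurable (A : set (borel K)).
Proof. by move=> oA; exact: sub_sigma_algebra. Qed.

Lemma closed_measurable_borel (K : ptopologicalType) (A : set K) :
  closed A -> measurable (A : set (borel K)).
Proof.
move=> cA; rewrite -(setCK A); apply: measurableC; apply: open_measurable_borel.
exact: closed_openC.
Qed.

Lemma cont_fun_measurable (K : ptopologicalType) (R : realType)
    (g : cont_fun K R) (D : set (borel K)) :
  measurable_fun D (g : borel K -> R).
Proof.
apply: measurable_funTS.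
apply: (measurability _ (measurable_realfun.RGenOpens.measurableE R)).
move=> _ [_ [a [b ->] <-]]; rewrite setTI; apply: open_measurable_borel.
have /continuousP gc : continuous (g : K -> R) by exact: cts_fun.
exact/gc/interval_open.
Qed.

Section charge_int_bounds.
Context (K : ptopologicalType) (R : realType).
Hypothesis cK : compact [set: K].
Variable mu : {charge set (borel K) -> \bar R}.

Let integrable_cont (g : cont_fun K R) (m : {finite_measure set (borel K) -> \bar R})
    (D : set (borel K)) : measurable D -> m.-integrable D (EFin \o (g : borel K -> R)).
Proof.
move=> mD; apply: measurable_bounded_integrable => //.
- by rewrite ltey_eq fin_num_measure.
- exact: cont_fun_measurable.
- exists (sup_norm g); split; first exact: num_real.
  by move=> M gM y _ /=; apply: (le_trans (ler_sup_norm g y cK)); exact: ltW.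
Qed.

Lemma Rintegral_supp (m : {finite_measure set (borel K) -> \bar R})
    (g : K -> R) (D : set K) :
  (forall y, ~ D y -> g y = 0) ->
  \int[m]_y g y = \int[m]_(y in (D : set (borel K))) g y.
Proof.
move=> g0; rewrite [RHS]Rintegral_mkcond; apply: eq_Rintegral => y _.
rewrite patchE; case: ifPn => // /negP yD; apply: g0 => Dy; apply: yD.
exact: mem_set.
Qed.

Lemma ler_Rintegral_cont (m : {finite_measure set (borel K) -> \bar R})
    (g : cont_fun K R) (D : set K) :
  clopen D -> (forall y, `|g y| <= 1) -> (forall y, ~ D y -> g y = 0) ->
  `|\int[m]_y g y| <= fine (m D).
Proof.
move=> [oD cD] g1 g0; have mD := open_measurable_borel oD.
rewrite (Rintegral_supp m g0).
apply: (le_trans (le_normr_Rintegral mD (integrable_cont g m mD))).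
have -> : fine (m D) = \int[m]_(y in (D : set (borel K))) (cst 1 y : R).
  by rewrite Rintegral_cst// mul1r.
apply: le_Rintegral => //.
- exact: (integrable_norm (integrable_cont g m mD)).
- exact: (finite_measure_integrable_cst m 1).
Qed.

Lemma charge_int_le_variation (g : cont_fun K R) (D : set K) :
  clopen D -> (forall y, `|g y| <= 1) -> (forall y, ~ D y -> g y = 0) ->
  (`|charge_int mu g|%:E <= abs_charge mu D)%E.
Proof.
move=> clD g1 g0; have mD := open_measurable_borel clD.1.
have -> : abs_charge mu D =
    (jordan_pos (hahnP mu) D + jordan_neg (hahnP mu) D)%E by [].
have fp : jordan_pos (hahnP mu) D \is a fin_num by rewrite fin_num_measure.
have fn : jordan_neg (hahnP mu) D \is a fin_num by rewrite fin_num_measure.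
rewrite -(fineK fp) -(fineK fn) -EFinD lee_fin /charge_int.
apply: (le_trans (ler_normB _ _)).
by apply: lerD; apply: ler_Rintegral_cont.
Qed.

(** The integrand is 1 on [F] and at least -1 on [D `\` F], which makes up for
the factor 2. *)
Lemma Rintegral_ge_plateau (m : {finite_measure set (borel K) -> \bar R})
    (g : cont_fun K R) (D F : set K) :
  clopen D -> closed F -> F `<=` D -> (forall y, F y -> g y = 1) ->
  (forall y, `|g y| <= 1) -> (forall y, ~ D y -> g y = 0) ->
  fine (m D) - 2 * fine (m (D `\` F)) <= \int[m]_y g y.
Proof.
move=> [oD cD] cF FD gF g1 g0; have mD := open_measurable_borel oD.
have mF := closed_measurable_borel cF.
have mDF : measurable (D `\` F : set (borel K)) by exact: measurableD.
rewrite (Rintegral_supp m g0).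
have DE : D = F `|` D `\` F by rewrite setDUK.
have mDE : fine (m D) = fine (m F) + fine (m (D `\` F)).
  rewrite -fineD ?fin_num_measure// -measureU// ?setDIK// -?DE//.
rewrite [X in \int[m]_(y in X) _]DE Rintegral_setU//; last 2 first.
- by rewrite -DE; exact: integrable_cont.
- by apply/disj_setPS => y [Fy []].
have -> : \int[m]_(y in (F : set (borel K))) g y = fine (m F).
  rewrite -[RHS]mul1r -Rintegral_cst//; apply: eq_Rintegral => y /set_mem.
  exact: gF.
have : -1 * fine (m (D `\` F)) <= \int[m]_(y in (D `\` F : set (borel K))) g y.
  rewrite -Rintegral_cst//; apply: le_Rintegral => //.
  - exact: finite_measure_integrable_cst.
  - exact: integrable_cont.
  - by move=> y _; have := g1 y; rewrite ler_norml => /andP[].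
by rewrite mDE; lra.
Qed.

Lemma jordan_pos_setI (A P N : set (borel K)) (muPN : hahn_decomposition mu P N) :
  measurable A -> jordan_pos muPN A = mu (A `&` P).
Proof.
by move=> mA; rewrite jordan_posE charge.cjordan_posE /crestr0 mem_set.
Qed.

Lemma jordan_neg_setI (A P N : set (borel K)) (muPN : hahn_decomposition mu P N) :
  measurable A -> jordan_neg muPN A = (- mu (A `&` N))%E.
Proof.
by move=> mA; rewrite jordan_negE charge.cjordan_negE /crestr0 mem_set.
Qed.

(** Inner regularity gives disjoint closed sets carrying almost all of the
positive and of the negative part of [mu] on [D]. A Urysohn function for the
pair, rescaled to take the values 1 and -1 there, nearly realizes the variation. *)
Lemma variation_approx (D : set K) (e : R) :
  hausdorff_space K -> regular_charge mu -> clopen D -> 0 < e ->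
  exists g : cont_fun K R, [/\ forall y, `|g y| <= 1,
    forall y, ~ D y -> g y = 0 & (abs_charge mu D <= (charge_int mu g + e)%:E)%E].
Proof.
move=> hK rmu clD e0; have mD := open_measurable_borel clD.1.
have e4 : 0 < e / 4 by rewrite divr_gt0.
have [[mP _] [mN _] _ PN0] := hahnP mu.
set P := hahn_pos mu in mP PN0; set N := hahn_neg mu in mN PN0.
have absE A : abs_charge mu A = (jordan_pos (hahnP mu) A + jordan_neg (hahnP mu) A)%E by [].
have inner (A : set (borel K)) : measurable A -> exists F : set K, [/\ closed F, F `<=` A &
    fine (abs_charge mu (A `\` F)) < e / 4].
  move=> mA; have [F [U [cF oU FA AU ltU]]] := rmu A (e / 4) mA e4.
  have clF : closed F by exact: compact_closed.
  have mF := closed_measurable_borel clF; have mU := open_measurable_borel oU.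
  exists F; split => //; rewrite -lte_fin fineK ?fin_num_measure//; last exact: measurableD.
  apply: le_lt_trans ltU; apply: le_measure; rewrite ?inE; [exact: measurableD..|].
  exact: setSD.
have [F1 [cF1 F1DP lt1]] := inner (D `&` P) (measurableI _ _ mD mP).
have [F2 [cF2 F2DN lt2]] := inner (D `&` N) (measurableI _ _ mD mN).
have mF1 := closed_measurable_borel cF1; have mF2 := closed_measurable_borel cF2.
have F21 : F2 `&` F1 = set0.
  apply/seteqP; split=> // y [/F2DN[_ Ny] /F1DP[_ Py]]; rewrite -PN0; by split.
have /(@uniform_separatorP _ R)[u [cu u01 u0 u1]] : uniform_separator F2 F1.
  by apply: (iffLR (normal_separatorP (R:=R))) => //; exact: compact_normal.
pose g : cont_fun K R :=
  cont_mul (2 *: (mkcts cu : cont_fun K R) - cont_indic R setT) (cont_indic R D).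
have gE y : g y = (2 * u y - 1) * \1_D y.
  rewrite -(cont_indicE R y clD); congr (_ * _).
  have -> : 1 = cont_indic R (@setT K) y by rewrite cont_indicE ?indicT//; exact: clopenT.
  by [].
have g1 y : `|g y| <= 1.
  have /andP[u0y u1y] : 0 <= u y <= 1.
    by have := u01 (u y) (ex_intro2 _ _ y I erefl); rewrite /= in_itv.
  rewrite gE normrM mulr_ile1//; first by rewrite ler_norml; apply/andP; split; lra.
  by rewrite indicE; case: (_ \in _); rewrite ?normr1 ?normr0.
have g0 y : ~ D y -> g y = 0.
  by move=> nDy; rewrite gE indicE memNset//= mulr0.
have gF1 y : F1 y -> g y = 1.
  move=> F1y; rewrite gE (u1 (u y)); last by exists y.
  by rewrite indicE mem_set ?mulr1//=; [lra|case: (F1DP _ F1y)].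
have gF2 y : F2 y -> (- g) y = 1.
  move=> F2y; have -> : (- g) y = - g y by [].
  rewrite gE (u0 (u y)); last by exists y.
  by rewrite indicE mem_set ?mulr1//=; [lra|case: (F2DN _ F2y)].
exists g; split=> //.
have := Rintegral_ge_plateau (jordan_pos (hahnP mu)) clD cF1
  (fun y h => (F1DP y h).1) gF1 g1 g0.
have g1' y : `|(- g) y| <= 1.
  by have -> : (- g) y = - g y by []; rewrite normrN.
have g0' y : ~ D y -> (- g) y = 0.
  by move=> h; have -> : (- g) y = - g y by []; rewrite g0// oppr0.
have := Rintegral_ge_plateau (jordan_neg (hahnP mu)) clD cF2
  (fun y h => (F2DN y h).1) gF2 g1' g0'.
have -> : \int[jordan_neg (hahnP mu)]_y (- g) y =
    - \int[jordan_neg (hahnP mu)]_y g y.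
  rewrite -mulN1r -RintegralZl//; last exact: integrable_cont.
  by apply: eq_Rintegral => y _; rewrite mulN1r.
have posF : fine (jordan_pos (hahnP mu) (D `\` F1)) < e / 4.
  apply: le_lt_trans lt1.
  have mDF : measurable (D `\` F1 : set (borel K)) by exact: measurableD.
  have mDPF : measurable (D `&` P `\` F1 : set (borel K)).
    by apply: measurableD => //; exact: measurableI.
  apply: fine_le; rewrite ?fin_num_measure//.
  have -> : jordan_pos (hahnP mu) (D `\` F1) = jordan_pos (hahnP mu) (D `&` P `\` F1).
    rewrite !jordan_pos_setI//; congr (mu _).
    by rewrite -/P !setDE; apply/seteqP; split => y /=; tauto.
  by rewrite absE leeDl.
have negF : fine (jordan_neg (hahnP mu) (D `\` F2)) < e / 4.
  apply: le_lt_trans lt2.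
  have mDF : measurable (D `\` F2 : set (borel K)) by exact: measurableD.
  have mDNF : measurable (D `&` N `\` F2 : set (borel K)).
    by apply: measurableD => //; exact: measurableI.
  apply: fine_le; rewrite ?fin_num_measure//.
  have -> : jordan_neg (hahnP mu) (D `\` F2) = jordan_neg (hahnP mu) (D `&` N `\` F2).
    rewrite !jordan_neg_setI//; congr (- mu _)%E.
    by rewrite -/N !setDE; apply/seteqP; split => y /=; tauto.
  by rewrite absE leeDr.
have fp : jordan_pos (hahnP mu) D \is a fin_num by rewrite fin_num_measure.
have fn : jordan_neg (hahnP mu) D \is a fin_num by rewrite fin_num_measure.
rewrite absE -(fineK fp) -(fineK fn) -EFinD lee_fin /charge_int.
by move: posF negF; lra.
Qed.

End charge_int_bounds.

(** * The two estimates *)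

Lemma limn_esup_ge_frequently (R : realType) (u : nat -> \bar R) (c : R) :
  (forall e N, 0 < e -> exists2 n, (N <= n)%N & ((c - e)%:E <= u n)%E) ->
  (c%:E <= limn_esup u)%E.
Proof.
move=> uc; apply: le_ereal_inf_tmp => _ [V [N _ NV] <-].
apply/lee_subgt0Pr => e e0; have [n Nn un] := uc e N e0.
rewrite -EFinB; apply: (le_trans un); apply: ereal_sup_ubound.
by exists n => //; apply: NV.
Qed.

Theorem lemma3p1 (R : realType) (K : ptopologicalType)
    (K_compact : compact [set: K]) (K_hausdorff : hausdorff_space K)
    (K_height : finite_height K)
    (T : {linear cont_fun K R -> cont_fun omega_itv R})
    (T_iso : isomorphism T) (T_incr : norm_increasing T)
    (t : R) (t_def : t = op_norm T)
    (nu : omega_itv -> {charge set (borel K) -> \bar R})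
    (nu_assoc : associated_measures T nu)
    (x : K) (x_deriv : cb_derivative K 1 x)
    (C : set K) (C_clopen : clopen C) (Cx : C x)
    (f : cont_fun K R)
    (s : R) (s_norm : s = sup_norm (T f))
    (s_sup : s = sup [set `|charge_int (nu i) f| | i in [set: omega_itv]])
    (s_le_t : s <= t) (s_gt1 : 1 < s)
    (f_x : f x = 1) (f_C : sup_norm (f \* \1_C) = 1) :
  ((2 * ((s - `|charge_int (nu None) f|) / (s - 1))
      - `|charge_int (nu None) (f \* \1_C)|)%:E
     <= limn_esup (fun n : nat => abs_charge (nu (Some n)) C))%E
  /\
  ((2 * ((s - `|charge_int (nu None) f|) / (s - 1))
      - `|charge_int (nu None) (f \* \1_C)|)%:E
     + abs_charge (nu None) (~` C) <= t%:E)%E.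
Proof.
have [bT _] := T_iso.
have cw : compact [set: omega_itv] := one_point_compactification_compact.
have nuT i (g : cont_fun K R) : charge_int (nu i) g = T g i by case: (nu_assoc i).
have Tfs i : `|T f i| <= s by rewrite s_norm; exact: ler_sup_norm.
set fC := cont_mul f (cont_indic R C).
have fCE : (f \* \1_C : K -> R) = fC.
  by apply/funext => y; rewrite /= -(cont_indicE R y C_clopen).
have f1 y : C y -> `|f y| <= 1.
  move=> Cy; rewrite -f_C fCE; apply: le_trans (ler_sup_norm fC y K_compact).
  by rewrite -fCE /= indicE mem_set// mulr1.
have test := exists_large_test _ K_compact K_hausdorff K_height bT T_incr
  x_deriv C_clopen Cx f_x f1 s_gt1 Tfs.
rewrite fCE !nuT; set c := _ - `|T fC None|; split.
  apply: limn_esup_ge_frequently => e N e0.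
  have [n [h [Nn h1 h0 ch]]] := test e N e0.
  exists n => //; apply: le_trans (charge_int_le_variation K_compact (nu (Some n)) C_clopen h1 h0).
  by rewrite lee_fin nuT; apply: le_trans ch (ler_norm _).
have nC : clopen (~` C) by exact: clopenC.
apply/lee_addgt0Pr => e e0; have e3 : 0 < e / 3 by rewrite divr_gt0.
have [g [g1 g0 gvar]] :=
  variation_approx K_compact K_hausdorff (nu_assoc None).1 nC e3.
have [N NTg] := omega_cvg (T g) e3.
have [n [h [Nn h1 h0 ch]]] := test _ N e3.
have hg y : `|(h + g) y| <= 1.
  have -> : (h + g) y = h y + g y by [].
  have [Cy|nCy] := pselect (C y).
    by rewrite (g0 y)// addr0.
  by rewrite h0// add0r.
have := le_trans (ler_norm _) (ler_op_norm (Some n : omega_itv) K_compact cw bT hg).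
rewrite -t_def linearD.
have -> : (T h + T g) (Some n) = T h (Some n) + T g (Some n) by [].
move=> Tt; apply: (le_trans (leeD2l _ gvar)); rewrite -!EFinD lee_fin nuT.
by have := ler_normlW (ltW (NTg n Nn)); move: ch; rewrite -/fC -/c; lra.
Qed.
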